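(* Let $B(1,2)=\langle a,b\mid bab^{-1}=a^2\rangle$. No left-ordering is isolated in $\mathcal{LO}(B(1,2))$, and the space $\mathcal{LO}(B(1,2))$ is homeomorphic to the Cantor set. Moreover, for every irrational number $\varepsilon$, the orbit of $\preceq_\varepsilon$ under the conjugacy action of $B(1,2)$ is dense in the subspace $V_a\subset\mathcal{LO}(B(1,2))$ formed by the left-orderings for which $a$ is positive, and the orbit of $\overline{\preceq}_\varepsilon$ is dense in the complementary subspace $V_{a^{-1}}$ formed by the left-orderings for which $a^{-1}$ is positive.
   Context: A left-ordering on a group $G$ is a left-invariant total order $\preceq$; $g$ is positive if $g\succ id$; a left-ordering is determined by its set of positive elements. The opposite $\overline{\preceq}$ of $\preceq$ is the left-ordering whose positive elements are the inverses of the $\preceq$-positive elements. The set $\mathcal{LO}(G)$ of all left-orderings on $G$ has the topology in which a basis of neighborhoods of $\preceq$ is given by the sets $V_{f_1,\ldots,f_k}$ of all left-orderings $\preceq'$ for which all $f_i$ are $\preceq'$-positive, where $\{f_1,\ldots,f_k\}$ runs over all finite sets of $\preceq$-positive elements. A left-ordering is isolated if its singleton is open. The group $G$ acts on $\mathcal{LO}(G)$ by conjugacy: the orbit of $\preceq$ consists of the left-orderings whose sets of positive elements are the sets $g^{-1}Pg$, $g\in G$, where $P$ is the set of $\preceq$-positive elements. Let $\xi:B(1,2)\to\mathrm{Homeo}_+(\mathbb{R})$ be the embedding given by $\xi(a):x\mapsto x+1$, $\xi(b):x\mapsto 2x$. For irrational $\varepsilon$, $\preceq_\varepsilon$ is the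 left-ordering on $B(1,2)$ whose set of positive elements is $\{g\in B(1,2)\mid\xi(g)(\varepsilon)>\varepsilon\}$, and $\overline{\preceq}_\varepsilon$ is its opposite. *)

(* Defs.v *)
From HB Require Import structures.
From mathcomp Require Import all_boot all_order all_algebra.
From mathcomp Require Import all_classical all_reals all_analysis.
From mathcomp Require Import ring lra.

Set Implicit Arguments.
Unset Strict Implicit.
Unset Printing Implicit Defensive.

Import Order.TTheory GRing.Theory Num.Theory.

Local Open Scope classical_set_scope.
Local Open Scope quotient_scope.
Local Open Scope group_scope.

(* [presented S] is the group with generators indexed by [I] and a relation    *)
(* u = v whenever S u v: words modulo the least congruence containing S and    *)
(* the free cancellations. The letter (i, false) stands for the generator i,   *)
(* and (i, true) for its inverse.                                              *)
Section Presentation.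
Variables (I : choiceType) (S : seq (I * bool) -> seq (I * bool) -> Prop).
Local Notation letter := (I * bool)%type.
Local Notation word := (seq letter).
Implicit Types (l : letter) (u v w : word).

Definition letterV l : letter := (l.1, ~~ l.2).
Definition wordV w : word := rev (map letterV w).

Inductive word_eq : word -> word -> Prop :=
| word_eq_rel u v of S u v : word_eq u v
| word_eq_cancel l : word_eq [:: l; letterV l] [::]
| word_eq_refl u : word_eq u u
| word_eq_sym u v of word_eq u v : word_eq v u
| word_eq_trans u v w of word_eq u v & word_eq v w : word_eq u w
| word_eq_cat u u' v v' of word_eq u u' & word_eq v v' :
    word_eq (u ++ v) (u' ++ v').

Definition word_eqb : rel word := fun u v => `[< word_eq u v >].

Lemma word_eqb_refl : reflexive word_eqb.
Proof. by move=> u; apply/asboolP; constructor. Qed.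

Lemma word_eqb_sym : symmetric word_eqb.
Proof. by move=> u v; apply/asboolP/asboolP; apply: word_eq_sym. Qed.

Lemma word_eqb_trans : transitive word_eqb.
Proof.
move=> v u w /asboolP uv /asboolP vw; apply/asboolP.
exact: word_eq_trans uv vw.
Qed.

Canonical word_equiv :=
  EquivRel word_eqb word_eqb_refl word_eqb_sym word_eqb_trans.

Definition presented : Type := {eq_quot word_equiv}.

HB.instance Definition _ := Choice.on presented.

Definition of_word w : presented := \pi_{eq_quot word_equiv} w.
Definition to_word (x : presented) : word := repr (x : {eq_quot word_equiv}).

Lemma to_wordK : cancel to_word of_word.
Proof. exact: reprK. Qed.

Lemma of_wordP u v : of_word u = of_word v <-> word_eq u v.
Proof.
split=> [/eqmodP/asboolP//|uv].
by apply/eqmodP/asboolP.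
Qed.

Lemma word_eqK w : word_eq (to_word (of_word w)) w.
Proof. by apply/of_wordP; rewrite to_wordK. Qed.

Lemma letterVK : involutive letterV.
Proof. by case=> i s; rewrite /letterV negbK. Qed.

Lemma wordVK : involutive wordV.
Proof.
move=> w; rewrite /wordV map_rev revK -map_comp.
by under eq_map => l do rewrite /= letterVK; rewrite map_id.
Qed.

Lemma word_eq_catV w : word_eq (w ++ wordV w) [::].
Proof.
elim: w => [|l w IH]; first by constructor.
apply: word_eq_trans (word_eq_cancel l).
have -> : (l :: w) ++ wordV (l :: w) =
    [:: l] ++ ((w ++ wordV w) ++ [:: letterV l]).
  by rewrite /wordV /= rev_cons -cats1 !catA.
rewrite -[in X in word_eq _ X]/([:: l] ++ ([::] ++ [:: letterV l])).
apply: word_eq_cat; first exact: word_eq_refl.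
by apply: word_eq_cat => //; exact: word_eq_refl.
Qed.

Lemma word_eq_Vcat w : word_eq (wordV w ++ w) [::].
Proof. by have := word_eq_catV (wordV w); rewrite wordVK. Qed.

Definition presented_one : presented := of_word [::].
Definition presented_mul (x y : presented) : presented :=
  of_word (to_word x ++ to_word y).
Definition presented_inv (x : presented) : presented :=
  of_word (wordV (to_word x)).

Lemma presented_mulE u v :
  presented_mul (of_word u) (of_word v) = of_word (u ++ v).
Proof. by apply/of_wordP; apply: word_eq_cat; apply: word_eqK. Qed.

Lemma presented_mulA : associative presented_mul.
Proof.
move=> x y z; rewrite -[x]to_wordK -[y]to_wordK -[z]to_wordK.
by rewrite !presented_mulE catA.
Qed.

Lemma presented_mul1g : left_id presented_one presented_mul.
Proof. by move=> x; rewrite -[x]to_wordK presented_mulE. Qed.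

Lemma presented_mulg1 : right_id presented_one presented_mul.
Proof. by move=> x; rewrite -[x]to_wordK presented_mulE cats0. Qed.

Lemma presented_mulVg : left_inverse presented_one presented_inv presented_mul.
Proof.
move=> x; rewrite -{2}[x]to_wordK presented_mulE.
exact/of_wordP/word_eq_Vcat.
Qed.

Lemma presented_mulgV :
  right_inverse presented_one presented_inv presented_mul.
Proof.
move=> x; rewrite -{1}[x]to_wordK presented_mulE.
exact/of_wordP/word_eq_catV.
Qed.

HB.instance Definition _ := isGroup.Build presented presented_mulA
  presented_mul1g presented_mulg1 presented_mulVg presented_mulgV.

Definition gen (i : I) : presented := of_word [:: (i, false)].

Lemma of_word_cat u v : of_word (u ++ v) = of_word u * of_word v.
Proof. by rewrite -presented_mulE. Qed.

Lemma of_wordV i : of_word [:: (i, true)] = (gen i)^-1.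
Proof.
apply: (mulgI (gen i)); rewrite mulgV -of_word_cat.
exact/of_wordP/word_eq_cancel.
Qed.

End Presentation.

(* B(1,2) = <a, b | b a b^-1 = a^2>; in words over [bool], a is [false] and b is
   [true]. *)
Definition B12_rel (u v : seq (bool * bool)) : Prop :=
  u = [:: (true, false); (false, false); (true, true)] /\
  v = [:: (false, false); (false, false)].

Definition B12 : groupType := presented B12_rel.
Definition B12a : B12 := gen B12_rel false.
Definition B12b : B12 := gen B12_rel true.
Local Notation a := B12a.
Local Notation b := B12b.

Lemma B12_relE : b * a * b^-1 = a ^+ 2.
Proof.
rewrite -of_wordV expgS expg1.
rewrite -(of_word_cat B12_rel [:: (true, false)] [:: (false, false)]).
rewrite -(of_word_cat _ _ [:: (true, true)]).
rewrite -(of_word_cat B12_rel [:: (false, false)] [:: (false, false)]).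
by apply/of_wordP/word_eq_rel; split.
Qed.

Section LeftOrderings.
Variable G : groupType.

Record leftOrdering := LeftOrdering {
  lo_le :> G -> G -> bool;
  lo_anti : antisymmetric lo_le;
  lo_trans : transitive lo_le;
  lo_total : total lo_le;
  lo_mul : forall z x y, lo_le x y -> lo_le (z * x) (z * y) }.

HB.instance Definition _ := gen_eqMixin leftOrdering.
HB.instance Definition _ := gen_choiceMixin leftOrdering.

Implicit Types (o : leftOrdering) (P : set G).

Definition positive o : set G := [set g | o 1 g && (g != 1)].

(* A set of positive elements determines the ordering x <= y iff x = y or      *)
(* x^-1 y is positive.                                                         *)
Definition is_positive_cone P : Prop :=
  [/\ ~ P 1, forall g h, P g -> P h -> P (g * h) &
      forall g, g <> 1 -> P g \/ P g^-1].

Definition cone_le P : rel G := fun x y => `[< x = y \/ P (x^-1 * y) >].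

Section OrderingOfCone.
Variables (P : set G) (coneP : is_positive_cone P).

Lemma cone_anti : antisymmetric (cone_le P).
Proof.
case: coneP => P1 PM _ x y /andP[/asboolP[//|Pxy] /asboolP[//|Pyx]].
by case: P1; have := PM _ _ Pxy Pyx; rewrite mulgA mulgK mulVg.
Qed.

Lemma cone_trans : transitive (cone_le P).
Proof.
case: coneP => _ PM _ y x z /asboolP[->//|Pxy] /asboolP[<-|Pyz].
  by apply/asboolP; right.
apply/asboolP; right.
by have := PM _ _ Pxy Pyz; rewrite mulgA mulgK.
Qed.

Lemma cone_total : total (cone_le P).
Proof.
case: coneP => _ _ PT x y; apply/orP.
have [->|xy] := eqVneq x y; first by left; apply/asboolP; left.
have [|Pxy|Pyx] := PT (x^-1 * y).
- by move=> /mulg1_eq; rewrite invgK; apply/eqP.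
- by left; apply/asboolP; right.
- by right; apply/asboolP; right; rewrite invgM invgK in Pyx.
Qed.

Lemma cone_mul z x y : cone_le P x y -> cone_le P (z * x) (z * y).
Proof.
move=> /asboolP[->|Pxy]; apply/asboolP; [by left|right].
by rewrite invgM mulgA mulgVK.
Qed.

Definition ordering_of_cone : leftOrdering :=
  LeftOrdering cone_anti cone_trans cone_total cone_mul.

Lemma positive_of_cone : positive ordering_of_cone = P.
Proof.
case: coneP => P1 _ _; apply/seteqP; split=> [g /andP[/asboolP[<-|]]|g Pg].
- by rewrite eqxx.
- by rewrite invg1 mul1g.
- apply/andP; split; first by apply/asboolP; right; rewrite invg1 mul1g.
  by apply/eqP => g1; apply: P1; rewrite -g1.
Qed.

End OrderingOfCone.

Lemma lo_refl o : reflexive o.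
Proof. by move=> x; have /orP[] := lo_total o x x. Qed.

Lemma positiveE o x y : o x y = (x == y) || (x^-1 * y \in positive o).
Proof.
apply/idP/orP => [oxy|[/eqP->|/set_mem/andP[+ _]]]; last 2 first.
- exact: lo_refl.
- by move=> /(lo_mul x); rewrite mulg1 mulgA mulgV mul1g.
have [|xy] := eqVneq x y; [by left|right].
apply/mem_set/andP; split.
  by have := lo_mul x^-1 oxy; rewrite mulVg.
by apply: contra xy => /eqP/mulg1_eq; rewrite invgK => ->.
Qed.

Lemma positive_inj : injective positive.
Proof.
move=> o o' oo'; have : lo_le o = lo_le o'.
  by apply/funext => x; apply/funext => y; rewrite !positiveE oo'.
case: o o' {oo'} => [r a1 t1 u1 m1] [r' a2 t2 u2 m2] /= rr'.
by subst r'; congr LeftOrdering; exact: Prop_irrelevance.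
Qed.

Lemma positive_cone o : is_positive_cone (positive o).
Proof.
split=> [|g h /andP[og g1] /andP[oh h1]|g /eqP g1].
- by move=> /andP[_]; rewrite eqxx.
- have ogh : o g (g * h) by have := lo_mul g oh; rewrite mulg1.
  apply/andP; split; first exact: lo_trans og ogh.
  apply: contra g1 => /eqP gh1; apply/eqP; apply: (@lo_anti o).
  by rewrite og andbT -gh1.
- have /orP[og|og] := lo_total o 1 g; first by left; apply/andP.
  right; apply/andP; split; last by rewrite invg_eq1.
  by have := lo_mul g^-1 og; rewrite mulVg mulg1.
Qed.

Lemma positive_coneV o : is_positive_cone [set g^-1 | g in positive o].
Proof.
have [P1 PM PT] := positive_cone o; split.
- by move=> [g Pg /eqP]; rewrite invg_eq1 => /eqP g1; apply: P1; rewrite -g1.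
- move=> _ _ [g Pg <-] [h Ph <-]; exists (h * g); first exact: PM.
  by rewrite invgM.
- move=> g /PT[Pg|Pg]; [right|left]; first by exists g.
  by exists g^-1 => //; rewrite invgK.
Qed.

Lemma positive_coneJ o g : is_positive_cone [set g^-1 * p * g | p in positive o].
Proof.
have [P1 PM PT] := positive_cone o; split.
- move=> [p Pp] /(congr1 (fun x => g * x * g^-1)).
  by rewrite !mulgA mulgV mul1g mulgK mulg1 mulgV => p1; apply: P1; rewrite -p1.
- move=> _ _ [p Pp <-] [q Pq <-]; exists (p * q); first exact: PM.
  by rewrite !mulgA mulgK.
- move=> x x1; have [|Pp|Pp] := PT (g * x * g^-1).
  + move=> /(congr1 (fun x => g^-1 * x * g)).
    by rewrite !mulgA mulVg mul1g mulgVK mulg1 mulVg.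
  + by left; exists (g * x * g^-1) => //; rewrite !mulgA mulVg mul1g mulgVK.
  + right; exists (g * x * g^-1)^-1 => //.
    by rewrite !invgM invgK !mulgA mulVg mul1g mulgVK.
Qed.

Definition lo_opposite o : leftOrdering := ordering_of_cone (positive_coneV o).

Definition lo_conjugate o (g : G) : leftOrdering :=
  ordering_of_cone (positive_coneJ o g).

Definition lo_orbit o : set leftOrdering := range (lo_conjugate o).

Definition lo_V (fs : seq G) : set leftOrdering :=
  [set o | [set` fs] `<=` positive o].

(* [set fs | [set` fs] `<=` positive o] consists of the (finite) lists of
   elements that are positive for o. *)
Definition lo_nbhs o : set_system leftOrdering :=
  filter_from [set fs : seq G | [set` fs] `<=` positive o] lo_V.

HB.instance Definition _ := hasNbhs.Build leftOrdering lo_nbhs.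

Lemma lo_nbhs_filter o : ProperFilter (nbhs o).
Proof.
apply: filter_from_proper => [|fs fso]; last by exists o.
apply: filter_from_filter => [|fs gs fso gso]; first by exists [::].
exists (fs ++ gs) => [f|o' o'fg].
  by rewrite /= mem_cat => /orP[/fso|/gso].
by split=> f ff; apply: o'fg; rewrite /= mem_cat ff ?orbT.
Qed.

Lemma lo_nbhs_singleton o (A : set leftOrdering) : nbhs o A -> A o.
Proof. by move=> [fs fso]; apply. Qed.

Lemma lo_nbhs_nbhs o (A : set leftOrdering) : nbhs o A -> nbhs o (nbhs^~ A).
Proof. by move=> [fs fso fsA]; exists fs => // o' fso'; exists fs. Qed.

HB.instance Definition _ := Nbhs_isNbhsTopological.Build leftOrdering
  lo_nbhs_filter lo_nbhs_singleton lo_nbhs_nbhs.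

End LeftOrderings.

Definition lo_isolated (G : groupType) (o : leftOrdering G) : Prop :=
  open [set o].

Definition homeomorphic (S T : topologicalType) : Prop :=
  exists (f : S -> T) (g : T -> S),
    [/\ cancel f g, cancel g f, continuous f & continuous g].

(* A is a dense subset of the subspace B: the closure of A relative to B is
   [closure A `&` B]. *)
Definition dense_in (T : topologicalType) (A B : set T) : Prop :=
  A `<=` B /\ B `<=` closure A.

Section AffineAction.
Variable R : realType.
Local Open Scope ring_scope.
Implicit Types (x e : R) (g h : B12).

Definition xi_letter (l : bool * bool) (x : R) : R :=
  match l with
  | (false, false) => x + 1
  | (false, true) => x - 1
  | (true, false) => 2 * x
  | (true, true) => x / 2
  end.

(* The leftmost letter acts last, so that xi (g * h) = xi g \o xi h. *)
Definition xi_word (w : seq (bool * bool)) (x : R) : R := foldr xi_letter x w.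

Definition xi (g : B12) : R -> R := xi_word (to_word g).

Lemma xi_word_cat u v x : xi_word (u ++ v) x = xi_word u (xi_word v x).
Proof. exact: foldr_cat. Qed.

Lemma xi_word_eq u v : word_eq B12_rel u v -> xi_word u =1 xi_word v.
Proof.
elim=> {u v}.
- by move=> _ _ [-> ->] x; rewrite /xi_word /=; field.
- by move=> [[] []] x; rewrite /xi_word /=; field.
- by [].
- by move=> u v _ uv x; rewrite uv.
- by move=> u v w _ uv _ vw x; rewrite uv vw.
- by move=> u u' v v' _ uu' _ vv' x; rewrite !xi_word_cat vv' uu'.
Qed.

Lemma xi_of_word w : xi (of_word B12_rel w) =1 xi_word w.
Proof. exact/xi_word_eq/word_eqK. Qed.

Lemma xi_a x : xi a x = x + 1.
Proof. by rewrite xi_of_word. Qed.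

Lemma xi_b x : xi b x = 2 * x.
Proof. by rewrite xi_of_word. Qed.

Lemma xi1 x : xi 1%g x = x.
Proof. by rewrite (xi_of_word [::]). Qed.

Lemma xiM g h x : xi (g * h)%g x = xi g (xi h x).
Proof. by rewrite xi_of_word xi_word_cat. Qed.

Lemma xi_lt g x y : x < y -> xi g x < xi g y.
Proof.
rewrite /xi; elim: (to_word g) => [//|[[] []] w IH] /IH /=; rewrite /xi_letter.
all: lra.
Qed.

Lemma xiVK g x : xi g (xi g^-1%g x) = x.
Proof. by rewrite -xiM mulgV xi1. Qed.

Lemma xi_inj g : injective (xi g).
Proof.
by move=> x y xy; have := xi1 x; rewrite -(mulVg g) xiM xy -xiM mulVg xi1.
Qed.

Lemma xi_aX i x : xi (a ^+ i)%g x = x + i%:R.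
Proof.
elim: i x => [|i IH] x; first by rewrite xi1 addr0.
by rewrite expgS xiM IH xi_a -natr1 addrA.
Qed.

Lemma xi_bX n x : xi (b ^+ n)%g x = 2 ^+ n * x.
Proof.
elim: n x => [|n IH] x; first by rewrite xi1 mul1r.
by rewrite expgS xiM IH xi_b exprS mulrA.
Qed.

Lemma conj_ab m : (a ^ (b ^- m) = a ^+ (2 ^ m))%g.
Proof.
elim: m => [|m IH]; first by rewrite invg1 conjg1.
have ab : (a ^ b^-1 = a ^+ 2)%g by rewrite /conjg invgK mulgA B12_relE.
by rewrite expgSr invgM conjgM ab conjXg IH -expgnA expnSr.
Qed.

Lemma normal_form g : exists m i j n,
  g = (b ^- m * (a ^+ i * a ^- j) * b ^+ n)%g.
Proof.
rewrite -(to_wordK g); elim: (to_word g) => [|l w [m [i [j [n]]]] IH].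
  by exists 0%N, 0%N, 0%N, 0%N; rewrite invg1 !mulg1.
have -> : of_word B12_rel (l :: w) =
    (of_word B12_rel [:: l] * of_word B12_rel w)%g by rewrite -of_word_cat.
have aj k p : commute (a ^+ k)%g (a ^- p)%g.
  by apply: commuteV; apply: commuteX; apply: commute_sym; apply: commuteX.
have ab1 : (a ^ b^-1 = a ^+ 2)%g by exact: (conj_ab 1).
rewrite {}IH; case: l => [[] []].
- rewrite of_wordV; exists m.+1, i, j, n.
  by rewrite expgSr invgM !mulgA.
- case: m => [|m].
    exists 0%N, (2 * i)%N, (2 * j)%N, n.+1.
    rewrite invg1 !mul1g expgS !mulgA; congr (_ * _)%g.
    rewrite !expgnA -ab1 -!conjXg -!conjVg.
    by rewrite /conjg !invgK !mulgA !mulgVK.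
  by exists m, i, j, n; rewrite expgSr invgM !mulgA mulgV mul1g.
- rewrite of_wordV; exists m, i, (j + 2 ^ m)%N, n.
  rewrite !mulgA; congr (_ * _)%g.
  rewrite [(a^-1 * _)%g]conjgC conjVg conj_ab -!mulgA; congr (_ * _)%g.
  by rewrite expgnDr invgM !mulgA aj.
- exists m, (2 ^ m + i)%N, j, n.
  rewrite !mulgA; congr (_ * _ * _)%g.
  by rewrite [(gen _ _ * _)%g]conjgC conj_ab -!mulgA expgnDr.
Qed.

Lemma xi_free e g : irrational e -> xi g e = e -> g = 1%g.
Proof.
move=> irr; have [m [i [j [n ->]]]] := normal_form g.
move=> /(congr1 (xi (b ^+ m)%g)); rewrite !xiM xiVK !xi_bX.
have -> x : xi (a ^- j)%g x = x - j%:R.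
  by apply: (@xi_inj (a ^+ j)%g); rewrite xiVK xi_aX subrK.
rewrite xi_aX => E.
have [mn|mn] := eqVneq m n.
  have ij : i = j.
    by apply/eqP; rewrite -(eqr_nat R) -mn in E *; apply/eqP; lra.
  by rewrite mn ij mulgV mulg1 mulVg.
case: irr; exists ((i%:R - j%:R) / (2 ^+ m - 2 ^+ n)) => //.
rewrite fmorph_div !rmorphB !rmorphXn !rmorph_nat /=.
have nz : 2 ^+ m - 2 ^+ n != 0 :> R.
  rewrite subr_eq0 -!natrX eqr_nat; apply: contra mn => /eqP mn.
  by apply/eqP/(@expnI 2).
by apply: (mulIf nz); rewrite divfK //; lra.
Qed.

Lemma affine_cone e :
  irrational e -> is_positive_cone [set g : B12 | xi g e > e].
Proof.
move=> irr; split=> [|g h /= ge he|g g1] /=.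
- by rewrite xi1 ltxx.
- by rewrite xiM; apply: lt_trans ge _; exact: xi_lt.
- have [lt|gt|/esym/(xi_free irr)//] := ltgtP e (xi g e); [by left|right].
  by have := xi_lt g^-1%g gt; rewrite -xiM mulVg xi1.
Qed.

Definition affine_ordering e (irr : irrational e) : leftOrdering B12 :=
  ordering_of_cone (affine_cone irr).

End AffineAction.

(* Main.v *)
From HB Require Import structures.
Require Import Defs.
From mathcomp Require Import all_boot all_order all_algebra.
From mathcomp Require Import all_classical all_reals all_analysis.
From mathcomp Require Import ring lra.

Set Implicit Arguments.
Unset Strict Implicit.
Unset Printing Implicit Defensive.

Import Order.TTheory GRing.Theory Num.Theory.

(** The whole theorem rests on one approximation property: if a is positive for
    a left-ordering o of B(1,2) and f_1, ..., f_k are positive for o, then there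
    is a nonempty open interval of points z with z < xi f_i z for every i
    ([positive_interval]). Each xi f is affine with slope a power of 2. When the
    slope exceeds 1, the inequality z < xi f z says that z lies to the right of
    the fixed point of f; when the slope is less than 1, to its left; when the
    slope is 1, f is a translation, some power of f is a power of a, and the
    inequality holds everywhere because a and f are both positive. So it is
    enough that the fixed point of an expanding positive f lies to the left of
    that of a contracting positive g ([fixpt_lt]). Suitable positive powers of f
    and g have inverse slopes, so their product is a positive translation, that
    is, a translation to the right; if g did not move the fixed point x of f to
    the right, this product would not move x to the right either.

    The conjugate of the ordering of base point eps by g is the ordering of base
    point xi g^-1 eps, and the orbit of every real number is dense in the line,
    since it is invariant under dyadic translations. Hence the conjugates of an
    affine ordering meet every basic neighborhood of o ([affine_orbit_dense]),
    and at least two of them lie in it, so that o is not isolated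
    ([lo_V_a_not_isolated]). The orderings for which a is negative are dealt
    with by passing to opposites, a homeomorphism that commutes with conjugacy.

    For the Cantor set, the sets of orderings for which a given element is
    positive are clopen, separate the orderings, and are countably many, while
    the space is compact because a limit along an ultrafilter of positive cones
    is a positive cone ([lo_compact]). Together with the absence of isolated
    points, this makes the space a Cantor set ([clopen_separated_cantor]). *)

Local Open Scope classical_set_scope.
Local Open Scope group_scope.

(** * Compact spaces separated by countably many clopen sets *)

Lemma clopen_indicator_continuous (S : topologicalType) (A : set S) :
  clopen A -> continuous (fun x => `[< A x >]).
Proof.
move=> cA; apply/continuousP => B _.
have [Bt|Bt] := pselect (B true); have [Bf|Bf] := pselect (B false).
- rewrite (_ : _ @^-1` _ = setT); first exact: openT.
  by apply/seteqP; split=> x //= _; case: asboolP.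
- rewrite (_ : _ @^-1` _ = A); first by case: cA.
  by apply/seteqP; split=> x /=; case: asboolP.
- rewrite (_ : _ @^-1` _ = ~` A); first by case: (clopenC A cA).
  by apply/seteqP; split=> x /=; case: asboolP.
- rewrite (_ : _ @^-1` _ = set0); first exact: open0.
  by apply/seteqP; split=> x //=; case: asboolP.
Qed.

Lemma zero_dimensional_hausdorff (S : topologicalType) :
  zero_dimensional S -> hausdorff_space S.
Proof.
move=> zS; rewrite open_hausdorff => x y /zS[A [cA Ax Ay]].
have [[oA _] [oAC _]] := (cA, clopenC A cA).
exists (A, ~` A) => /=; first by split; apply/mem_set.
by split=> //; rewrite setICr.
Qed.

Lemma compact_bijection_inverse (S T : topologicalType) (f : S -> T)
    (g : T -> S) :
  compact [set: S] -> hausdorff_space T -> continuous f ->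
  cancel f g -> cancel g f -> continuous g.
Proof.
move=> cS hT cf fK gK; apply/continuous_closedP => A cA.
have -> : g @^-1` A = f @` A.
  apply/seteqP; split=> [y Ay|_ [x Ax <-]] /=; last by rewrite fK.
  by exists (g y).
apply: (compact_closed hT); apply: continuous_compact.
  exact: continuous_subspaceT.
exact: subclosed_compact cA cS _.
Qed.

(** The indicators of the sets U n map S continuously and injectively to the
    sequences of booleans. The topology that this map induces on the points of S
    is coarser than that of S, hence still compact and without isolated points;
    it is moreover pseudometric and zero-dimensional, so that the
    characterization of the Cantor space applies to it. Compactness of S makes
    the resulting continuous bijection to the Cantor space a homeomorphism,
    without comparing the two topologies. *)
Lemma clopen_separated_cantor (R : realType) (S : topologicalType) (x0 : S)
    (U : nat -> set S) :
    compact [set: S] -> (forall x : S, ~ open [set x]) ->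
    (forall n, clopen (U n)) ->
    (forall x y, x <> y -> exists2 n, U n x & ~ U n y) ->
  homeomorphic S cantor_space.
Proof.
move=> cS pS cU sepU.
pose C : pseudoPMetricType R := tree_of (fun=> bool).
pose phi : S -> C := fun x n => `[< U n x >].
have cphi : continuous phi.
  move=> x; apply/cvg_sup => n V [_ [[W oW <-]] Wx WV].
  apply: filterS (WV) _; apply: open_nbhs_nbhs; split=> //.
  have /continuousP := clopen_indicator_continuous (cU n).
  exact.
pose W : pseudoMetricType R := initial_topology phi.
pose T : pseudoPMetricType R := HB.pack W (isPointed.Build W x0).
have phiT : continuous (phi : T -> C) by exact: initial_continuous.
pose j : S -> T := id.
have cj : continuous j by exact: continuous_comp_initial.
have cUT n : clopen (U n : set T).
  rewrite (_ : U n = phi @^-1` (proj n @^-1` [set true])).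
    apply: preimage_clopen phiT.
    apply: (@preimage_clopen C _ (proj n) [set true]).
      by split; [exact: discrete_open|exact: discrete_closed].
    exact: proj_continuous.
  by apply/seteqP; split=> x /= /asboolP.
have zT : zero_dimensional T.
  by move=> x y /eqP/sepU[n Ux Uy]; exists (U n).
have hT : hausdorff_space T.
  exact: zero_dimensional_hausdorff.
have cT : compact [set: T].
  rewrite -(_ : j @` setT = setT); last first.
    by apply/seteqP; split=> // x _; exists x.
  by apply: continuous_compact => //; exact: continuous_subspaceT.
have pT : perfect_set [set: T].
  apply/perfectTP => x ox; apply: (pS x).
  exact: (iffLR (continuousP j) cj _ ox).
have [f [cf _]] := @homeomorphism_cantor_like R T (And4 pT cT hT zT).
have bf : cancel f f^-1 by move=> y; rewrite funK ?inE.
have fb : cancel (f^-1) f by move=> x; rewrite invK ?inE.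
have cg : continuous (f^-1 : T -> cantor_space).
  exact: (compact_bijection_inverse cantor_space_compact hT cf bf fb).
exists (f^-1 \o j), f; split.
- exact: fb.
- exact: bf.
- by move=> x; apply: continuous_comp; [exact: cj|exact: cg].
- apply: (@compact_bijection_inverse _ _ (f^-1 \o j) f cS
    cantor_space_hausdorff _ fb bf).
  by move=> x; apply: continuous_comp; [exact: cj|exact: cg].
Qed.

(** * The space of left-orderings of a group *)

Section LeftOrderingSpace.
Variable G : groupType.
Implicit Types (o : leftOrdering G) (f g h : G) (fs : seq G).

Lemma positiveV o g : positive o g -> ~ positive o g^-1.
Proof.
have [P1 PM _] := positive_cone o.
by move=> Pg PgV; apply: P1; have := PM _ _ Pg PgV; rewrite mulgV.
Qed.

Lemma positiveX o g n : (0 < n)%N -> positive o g -> positive o (g ^+ n).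
Proof.
have [_ PM _] := positive_cone o.
elim: n => [//|[|n] IH _ Pg]; first by rewrite expg1.
by rewrite expgS; apply: PM => //; exact: IH.
Qed.

Lemma positive_opposite o g : positive (lo_opposite o) g <-> positive o g^-1.
Proof.
rewrite positive_of_cone; split=> [[h Ph <-]|Pg]; first by rewrite invgK.
by exists g^-1 => //; rewrite invgK.
Qed.

Lemma positive_conjugate o g h :
  positive (lo_conjugate o g) h <-> positive o (g * h * g^-1).
Proof.
rewrite positive_of_cone; split=> [[p Pp <-]|Ph].
  by rewrite !mulgA mulgV mul1g mulgK.
by exists (g * h * g^-1) => //; rewrite !mulgA mulVg mul1g mulgVK.
Qed.

Lemma lo_oppositeK : involutive (@lo_opposite G).
Proof.
move=> o; apply: positive_inj; apply/seteqP; split=> g.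
  by move=> /positive_opposite/positive_opposite; rewrite invgK.
by move=> Pg; apply/positive_opposite/positive_opposite; rewrite invgK.
Qed.

Lemma lo_opposite_conjugate o g :
  lo_opposite (lo_conjugate o g) = lo_conjugate (lo_opposite o) g.
Proof.
have VJ h : (g * h * g^-1)^-1 = g * h^-1 * g^-1 by rewrite !invgM invgK mulgA.
apply: positive_inj; apply/seteqP; split=> h.
  move=> /positive_opposite/positive_conjugate Ph.
  by apply/positive_conjugate/positive_opposite; rewrite VJ.
move=> /positive_conjugate/positive_opposite; rewrite VJ => Ph.
exact/positive_opposite/positive_conjugate.
Qed.

Lemma lo_V1 o g : lo_V [:: g] o <-> positive o g.
Proof.
split=> [|Pg f /=]; first by apply; rewrite /= mem_seq1.
by rewrite mem_seq1 => /eqP ->.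
Qed.

Lemma lo_V_cons g fs : lo_V (g :: fs) = lo_V [:: g] `&` lo_V fs.
Proof.
apply/seteqP; split=> o => [Po|[/lo_V1 Pg Pfs]].
  split; first by apply/lo_V1/Po; rewrite /= mem_head.
  by move=> f ffs; apply: Po; rewrite /= inE [f \in fs]ffs orbT.
by move=> f; rewrite /= inE => /orP[/eqP->//|/Pfs].
Qed.

(** This is totality of the orderings, and the reason why the basic sets of one
    element are clopen. *)
Lemma lo_V1C g : g <> 1 -> lo_V [:: g^-1] = ~` lo_V [:: g].
Proof.
move=> g1; apply/seteqP; split=> o.
  by move=> /lo_V1 PgV /lo_V1 /positiveV.
by have [_ _ PT] := positive_cone o; case: (PT g g1) => /lo_V1.
Qed.

Lemma lo_V_open fs : open (@lo_V G fs).
Proof. by rewrite openE => o ofs; exists fs. Qed.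

Lemma lo_V1_clopen g : clopen (lo_V [:: g]).
Proof.
split; first exact: lo_V_open.
have [->|/eqP g1] := eqVneq g 1.
  rewrite (_ : lo_V _ = set0); first exact: closed0.
  by apply/seteqP; split=> // o /lo_V1; case: (positive_cone o).
by rewrite -[X in lo_V [:: X]]invgK lo_V1C ?closedC; [exact: lo_V_open|
  move/eqP; rewrite invg_eq1 => /eqP].
Qed.

(** Given an ultrafilter, the elements that are positive for almost every
    ordering form a positive cone: of g and g^-1, exactly one is almost always
    positive when g is not trivial. The ordering of this cone is the limit. *)
Lemma lo_compact : compact [set: leftOrdering G].
Proof.
rewrite compact_ultra => F uF _; pose P g := F (lo_V [:: g]).
have coneP : is_positive_cone P.
  split.
  - move=> F1; apply: (@filter_not_empty _ F); apply: filterS F1 => o /lo_V1.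
    by case: (positive_cone o).
  - move=> g h; apply: filterS2 => o /lo_V1 Pg /lo_V1 Ph.
    by apply/lo_V1; case: (positive_cone o) => _ PM _; apply: PM.
  - move=> g g1; rewrite /P (lo_V1C g1).
    exact: in_ultra_setVsetC.
exists (ordering_of_cone coneP); split=> // A [fs].
rewrite /= positive_of_cone => fsP VA; apply: filterS VA _.
elim: fs fsP => [_|g fs IH fsP].
  by apply: filterS (filterT : F setT) => o _ f.
rewrite lo_V_cons; apply: filterI; first by apply: fsP; rewrite /= mem_head.
by apply: IH => f ffs; apply: fsP; rewrite /= inE [f \in fs]ffs orbT.
Qed.

Lemma lo_separated o o' :
  o <> o' -> exists2 g, lo_V [:: g] o & ~ lo_V [:: g] o'.
Proof.
move=> oo'; apply: contrapT => sep; apply: oo'; apply: positive_inj.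
have sub g : positive o g -> positive o' g.
  move=> Pg; apply: contrapT => Pg'.
  by apply: sep; exists g; [exact/lo_V1|move/lo_V1].
apply/seteqP; split=> // g Pg'.
have [P1' _ _] := positive_cone o'; have [_ _ /(_ g)[|//|]] := positive_cone o.
  by move=> g1; apply: P1'; rewrite -g1.
by move=> /sub /(positiveV Pg').
Qed.

Lemma lo_opposite_continuous : continuous (@lo_opposite G).
Proof.
move=> o A [fs fsP VA]; exists [seq f^-1 | f <- fs].
  by move=> _ /mapP[f ffs ->]; apply/positive_opposite/fsP.
move=> o' Po'; apply: VA => f ffs; apply/positive_opposite/Po'.
exact: map_f.
Qed.

(** Taking opposites is a continuous involution that commutes with conjugacy, so
    it carries isolated points, orbits and dense subsets to such. *)
Lemma lo_isolated_opposite o : lo_isolated o -> lo_isolated (lo_opposite o).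
Proof.
move=> oo; have := iffLR (continuousP _) lo_opposite_continuous _ oo.
congr open; apply/seteqP; split=> o' /= => [<-|->]; by rewrite lo_oppositeK.
Qed.

Lemma lo_orbit_opposite o :
  lo_orbit (lo_opposite o) = @lo_opposite G @^-1` lo_orbit o.
Proof.
apply/seteqP; split=> o' => [[g _ <-]|[g _ oo']] /=.
  by rewrite -lo_opposite_conjugate lo_oppositeK; exists g.
by exists g => //; rewrite -lo_opposite_conjugate oo' lo_oppositeK.
Qed.

Lemma lo_V1_opposite g : lo_V [:: g^-1] = @lo_opposite G @^-1` lo_V [:: g].
Proof.
apply/seteqP; split=> o => [/lo_V1 Pg|/lo_V1/positive_opposite]; last first.
  by move=> ?; exact/lo_V1.
exact/lo_V1/positive_opposite.
Qed.

Lemma dense_in_opposite (A B : set (leftOrdering G)) :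
  dense_in A B ->
  dense_in (@lo_opposite G @^-1` A) (@lo_opposite G @^-1` B).
Proof.
move=> [AB BA]; split=> o => [/AB //|/BA clA N No].
have : nbhs (lo_opposite o) (@lo_opposite G @^-1` N).
  by apply: lo_opposite_continuous; rewrite /= lo_oppositeK.
by move=> /clA [] p [Ap Np]; exists (lo_opposite p); rewrite /= lo_oppositeK.
Qed.

End LeftOrderingSpace.

(** * The affine action of B(1,2) *)

Section AffineGroup.
Variable R : realType.
Local Open Scope ring_scope.
Implicit Types (x y z e : R) (f g h : B12).
Local Notation a := B12a.
Local Notation b := B12b.

Lemma xiK g x : xi g^-1%g (xi g x) = x.
Proof. by rewrite -xiM mulVg xi1. Qed.

Lemma xi_aVX j x : xi (a ^- j)%g x = x - j%:R.
Proof. by apply: (@xi_inj _ (a ^+ j)%g); rewrite xiVK xi_aX subrK. Qed.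

Lemma xi_le_mono g x y : (xi g x <= xi g y) = (x <= y).
Proof.
have [/(xi_lt g)/ltW -> //|/(xi_lt g)|->] := ltgtP x y; last exact: lexx.
by rewrite ltNge => /negbTE.
Qed.

Lemma xi_lt_mono g x y : (xi g x < xi g y) = (x < y).
Proof. by rewrite !ltNge xi_le_mono. Qed.

(** Clearing the denominators of the normal form: 2 ^ m is at once the
    denominator of the slope and a denominator of the translation part. *)
Lemma xi_dyadic g : exists m n i j : nat,
  forall x, 2 ^+ m * xi g x = 2 ^+ n * x + (i%:R - j%:R).
Proof.
have [m [i [j [n ->]]]] := normal_form g; exists m, n, i, j => x.
by rewrite -xi_bX -mulgA xiM xiVK xiM xi_bX xiM xi_aVX xi_aX addrAC addrA.
Qed.

Definition slope g : R := xi g 1 - xi g 0.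

Lemma xi_affine g x : xi g x = slope g * x + xi g 0.
Proof.
have [m [n [i [j E]]]] := xi_dyadic g.
have m0 : (2 : R) ^+ m != 0 by rewrite expf_neq0.
apply: (mulfI m0); rewrite mulrDr mulrA mulrBr !E; ring.
Qed.

Lemma slopeM g h : slope (g * h)%g = slope g * slope h.
Proof.
rewrite /slope !xiM [xi g (xi h 1)]xi_affine [xi g (xi h 0)]xi_affine /slope.
ring.
Qed.

Lemma slope1 : slope 1%g = 1.
Proof. by rewrite /slope !xi1 subr0. Qed.

Lemma slopeX g n : slope (g ^+ n)%g = slope g ^+ n.
Proof. by elim: n => [|n IH]; rewrite ?slope1 // expgS exprS slopeM IH. Qed.

Lemma slopeV g : slope g^-1%g = (slope g)^-1.
Proof.
have E : slope g^-1%g * slope g = 1 by rewrite -slopeM mulVg slope1.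
have nz : slope g != 0.
  by apply: contra_eq_neq E => ->; rewrite mulr0 eq_sym oner_neq0.
by apply: (mulIf nz); rewrite E mulVf.
Qed.

Lemma slope_gt0 g : 0 < slope g.
Proof. by rewrite subr_gt0; apply: xi_lt; exact: ltr01. Qed.

Lemma slope_gt1 g : 1 < slope g -> exists2 p, (0 < p)%N & slope g = 2 ^+ p.
Proof.
have [m [n [i [j E]]]] := xi_dyadic g.
have m0 : 0 < (2 : R) ^+ m by rewrite exprn_gt0.
have sE : 2 ^+ m * slope g = 2 ^+ n.
  by rewrite mulrBr !E; ring.
move=> s1; have mn : (m < n)%N.
  by rewrite -(ltr_eXn2l (ltr1n R 2)) -sE ltr_pMr.
exists (n - m)%N; first by rewrite subn_gt0.
by apply: (mulfI (lt0r_neq0 m0)); rewrite sE -exprD subnKC // ltnW.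
Qed.

(** The stabilizer of an irrational point such as pi is trivial. *)
Lemma xi_faithful g h : xi (R := R) g =1 xi h -> g = h.
Proof.
move=> gh; apply: (mulIg h^-1%g); rewrite mulgV.
by apply: (xi_free (@pi_irrationnal R)); rewrite xiM gh xiVK.
Qed.

(** It suffices to use the translations by (i - j) / 2 ^ m, with m so large that
    the step 1 / 2 ^ m is smaller than the length of the interval. *)
Lemma orbit_dense e x y : x < y -> exists g, x < xi g e < y.
Proof.
move=> xy.
have [m xym] : exists m : nat, 1 < 2 ^+ m * (y - x).
  exists (Num.truncn (y - x)^-1).+1.
  have d0 : 0 < y - x by rewrite subr_gt0.
  rewrite -ltr_pdivrMr // mul1r.
  apply: lt_trans (truncnS_gt _) _.
  by rewrite -natrX ltr_nat ltn_expl.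
(* After scaling by 2 ^ m, the first integer beyond the left end of the
   interval falls inside it. *)
pose t := 2 ^+ m * (x - e); pose k := Num.floor t.
have k1 : k%:~R <= t by exact: floor_le.
have k2 : t < k%:~R + 1 by rewrite -[1]/(1%:~R) -intrD; exact: floorD1_gt.
have m0 : 0 < (2 : R) ^+ m by rewrite exprn_gt0.
have trans i j : exists g, 2 ^+ m * xi g e = 2 ^+ m * e + (i%:R - j%:R).
  exists (b ^- m * (a ^+ i * a ^- j) * b ^+ m)%g.
  by rewrite -xi_bX -mulgA xiM xiVK xiM xi_bX xiM xi_aVX xi_aX addrAC addrA.
have [i [j kE]] : exists i j : nat, k%:~R + 1 = i%:R - j%:R :> R.
  case: (k) => n; first by exists n.+1, 0%N; rewrite subr0 -natr1.
  by exists 0%N, n; rewrite NegzE mulrNz -pmulrn -natr1; ring.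
have [g gE] := trans i j; exists g.
rewrite -(ltr_pM2l m0) -[X in _ && X](ltr_pM2l m0) gE -kE.
move: k1 k2 xym; rewrite /t; lra.
Qed.

(** * Positive elements and fixed points *)

(** The fixed point of xi g when its slope is not 1. *)
Definition fixpt g : R := xi g 0 / (1 - slope g).

Lemma lt_xi_expanding g z : 1 < slope g -> (z < xi g z) = (fixpt g < z).
Proof.
move=> s1; have s0 : 0 < slope g - 1 by rewrite subr_gt0.
rewrite /fixpt -opprB invrN mulrN -mulNr ltr_pdivrMr // xi_affine.
by apply/idP/idP; lra.
Qed.

Lemma lt_xi_contracting g z : slope g < 1 -> (z < xi g z) = (z < fixpt g).
Proof.
move=> s1; have s0 : 0 < 1 - slope g by rewrite subr_gt0.
by rewrite /fixpt ltr_pdivlMr // xi_affine; apply/idP/idP; lra.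
Qed.

Lemma xiX_le g x n : xi g x <= x -> xi (g ^+ n)%g x <= x.
Proof.
move=> gx; elim: n => [|n IH]; first by rewrite xi1.
by rewrite expgS xiM; apply: le_trans gx; rewrite xi_le_mono.
Qed.

(** A translation by (i - j) / 2 ^ m has 2 ^ m-th power a ^ (i - j), by
    faithfulness; were i <= j, the product of this power with a ^ (j - i) would
    be a positive element equal to 1. *)
Lemma positive_translation (o : leftOrdering B12) g :
  positive o a -> positive o g -> slope g = 1 -> 0 < xi g (0 : R).
Proof.
move=> Pa Pg s1; have tr x : xi g x = x + xi g 0 by rewrite xi_affine s1 mul1r.
have [m [n [i [j E]]]] := xi_dyadic g.
have mn : 2 ^+ m = 2 ^+ n :> R.
  by have := E 1; have := E 0; rewrite (tr 1); lra.
have trX k x : xi (g ^+ k)%g x = x + k%:R * xi g 0.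
  elim: k => [|k IH]; first by rewrite xi1 mul0r addr0.
  by rewrite expgS xiM IH tr -natr1; ring.
have gij : (g ^+ (2 ^ m) * a ^+ j = a ^+ i)%g.
  apply: xi_faithful => x; rewrite xiM trX !xi_aX natrX E; ring.
have [P1 PM _] := positive_cone o.
rewrite -(pmulr_rgt0 _ (_ : 0 < 2 ^+ m)) ?exprn_gt0 // E mulr0 add0r subr_gt0.
rewrite ltr_nat ltnNge; apply/negP => ij.
have Pgm : positive o (g ^+ (2 ^ m))%g by apply: positiveX; rewrite ?expn_gt0.
have ga : (g ^+ (2 ^ m) * a ^+ (j - i) = 1)%g.
  by apply: (mulIg (a ^+ i)%g); rewrite mul1g -mulgA -expgnDr subnK.
apply: P1; rewrite -ga; have [->|ij0] := posnP (j - i); first by rewrite mulg1.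
exact: PM (positiveX ij0 Pa).
Qed.

(** With f of slope 2 ^ p and g of slope 2 ^ -q, the element f ^ q g ^ p is a
    positive translation. If g did not move the fixed point of f to the right,
    neither would f ^ q g ^ p, against [positive_translation]. *)
Lemma fixpt_lt (o : leftOrdering B12) f g :
  positive o a -> positive o f -> positive o g ->
  1 < slope f -> slope g < 1 -> fixpt f < fixpt g.
Proof.
move=> Pa Pf Pg sf sg; rewrite -lt_xi_contracting // ltNge; apply/negP => gx.
have fx : xi f (fixpt f) <= fixpt f by rewrite leNgt lt_xi_expanding // ltxx.
have [p p0 fE] := slope_gt1 sf.
have [q q0 gE] : exists2 q, (0 < q)%N & slope g^-1%g = 2 ^+ q.
  by apply: slope_gt1; rewrite slopeV invf_gt1 // slope_gt0.
pose h := (f ^+ q * g ^+ p)%g.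
have sh : slope h = 1.
  rewrite slopeM !slopeX fE -[g]invgK slopeV gE exprVn -!exprM mulnC.
  by rewrite mulfV // expf_neq0.
have Ph : positive o h.
  by have [_ PM _] := positive_cone o; apply: PM; exact: positiveX.
have := positive_translation Pa Ph sh.
have : xi h (fixpt f) <= fixpt f.
  rewrite xiM; apply: le_trans (xiX_le q fx).
  by rewrite xi_le_mono xiX_le.
by rewrite xi_affine sh; lra.
Qed.

(** The bounds x and y replace the maximum of A and the minimum of B because
    either list may be empty. *)
Lemma seq_gap (A B : seq R) : (forall x y, x \in A -> y \in B -> x < y) ->
  exists x y, [/\ x < y, {in A, forall z, z <= x} & {in B, forall z, y <= z}].
Proof.
move=> AB; have [x Ax xB] : exists2 x,
    {in A, forall z, z <= x} & {in B, forall z, x < z}.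
  elim: A AB => [_|c A IH AB].
    elim: B => [|d B [x _ xB]]; first by exists 0.
    exists (Num.min x (d - 1)) => // z; rewrite inE => /orP[/eqP->|/xB xz].
      by rewrite gt_min; apply/orP; right; lra.
    by rewrite gt_min xz.
  have [|x Ax xB] := IH.
    by move=> x y xA; apply: AB; rewrite inE xA orbT.
  exists (Num.max x c) => z.
    by rewrite inE le_max => /orP[/eqP->|/Ax->//]; rewrite lexx orbT.
  by move=> zB; rewrite gt_max xB //= AB ?mem_head.
suff [y xy yB] : exists2 y, x < y & {in B, forall z, y <= z} by exists x, y.
elim: B xB {AB} => [_|d B IH xB]; first by exists (x + 1) => //; lra.
have [|y xy yB] := IH; first by move=> z zB; apply: xB; rewrite inE zB orbT.
exists (Num.min y d); first by rewrite lt_min xy xB ?mem_head.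
by move=> z; rewrite inE ge_min => /orP[/eqP->|/yB->//]; rewrite lexx orbT.
Qed.

(** The conditions z < xi f z for the expanding f bound z from below by their
    fixed points, those for the contracting f bound it from above, and the
    translations impose nothing. *)
Lemma positive_interval (o : leftOrdering B12) (fs : seq B12) :
  positive o a -> [set` fs] `<=` positive o ->
  exists x y, x < y /\
    forall z, x < z < y -> forall f, f \in fs -> z < xi f z.
Proof.
move=> Pa Pfs.
have [|x [y [xy Ax yB]]] := @seq_gap [seq fixpt f | f <- fs & 1 < slope f]
    [seq fixpt f | f <- fs & slope f < 1].
  move=> _ _ /mapP[f + ->] /mapP[g + ->]; rewrite !mem_filter.
  by move=> /andP[sf /Pfs Pf] /andP[sg /Pfs Pg]; exact: fixpt_lt Pa Pf Pg sf sg.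
exists x, y; split=> // z /andP[xz zy] f ffs.
have [sf|sf|sf] := ltgtP (slope f) 1.
- rewrite lt_xi_contracting //; apply: lt_le_trans zy (yB _ _).
  by apply: map_f; rewrite mem_filter sf.
- rewrite lt_xi_expanding //; apply: le_lt_trans (Ax _ _) xz.
  by apply: map_f; rewrite mem_filter sf.
- rewrite xi_affine sf mul1r ltrDl.
  exact: positive_translation Pa (Pfs _ ffs) sf.
Qed.

Lemma affine_orderingP e (irr : irrational e) g :
  positive (affine_ordering irr) g <-> e < xi g e.
Proof. by rewrite positive_of_cone. Qed.

(** Conjugation moves the base point: the conjugate by g of the ordering of base
    point e is the ordering of base point xi g^-1 e. *)
Lemma positive_conjugate_affine e (irr : irrational e) g h :
  positive (lo_conjugate (affine_ordering irr) g) h <->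
  xi g^-1%g e < xi h (xi g^-1%g e).
Proof.
rewrite positive_conjugate affine_orderingP -mulgA !xiM.
by rewrite -{1}(xiVK g e) xi_lt_mono.
Qed.

Lemma affine_orbit_dense e (irr : irrational e) :
  dense_in (lo_orbit (affine_ordering irr)) (lo_V [:: a]).
Proof.
split=> [_ [g _ <-]|o /lo_V1 Pa N [fs fsP VN]].
  by apply/lo_V1/positive_conjugate_affine; rewrite xi_a ltrDl ltr01.
have [x [y [xy fsxy]]] := positive_interval Pa fsP.
have [g gxy] := orbit_dense e xy.
exists (lo_conjugate (affine_ordering irr) g^-1%g); split.
  by exists g^-1%g.
apply: VN => f ffs; apply/positive_conjugate_affine; rewrite invgK.
exact: fsxy ffs.
Qed.

(** A neighborhood of o contains the orderings based at all the points of some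
    interval that lie in the orbit of pi, and two such orderings differ: a
    conjugate of b whose fixed point falls between the base points is positive
    for one of them only. *)
Lemma lo_V_a_not_isolated (o : leftOrdering B12) :
  positive o a -> ~ lo_isolated o.
Proof.
move=> Pa oo; have [fs fsP VO] : nbhs o [set o] by exact: open_nbhs_nbhs.
have [x [y [xy fsxy]]] := positive_interval Pa fsP.
pose piO g := lo_conjugate (affine_ordering (@pi_irrationnal R)) g^-1%g.
have piOP g h : positive (piO g) h <-> xi g (pi : R) < xi h (xi g pi).
  by rewrite positive_conjugate_affine invgK.
have piOE g : x < xi g pi < y -> piO g = o.
  by move=> gxy; apply: VO => f ffs; apply/piOP; exact: fsxy ffs.
have [g1 /andP[xg1 g1y]] := orbit_dense pi xy.
have [g2 /andP[g12 g2y]] := orbit_dense pi g1y.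
have [g0 /andP[g10 g02]] := orbit_dense 0 g12.
(* b fixes 0, so h expands about xi g0 0. *)
pose h := (g0 * b * g0^-1)%g.
have hE z : (z < xi h z) = (xi g0 0 < z).
  rewrite -(xiVK g0 z) !xiM xiK xi_b !xi_lt_mono.
  by apply/idP/idP; lra.
have : positive (piO g2) h by apply/piOP; rewrite hE.
rewrite piOE ?(lt_trans xg1 g12) // -(piOE g1) ?xg1 //.
by move=> /piOP; rewrite hE ltNge (ltW g10).
Qed.

End AffineGroup.

(** * The theorem *)

Theorem mainTheorem5 (R : realType) :
  [/\ forall o : leftOrdering B12, ~ lo_isolated o,
      homeomorphic (leftOrdering B12) cantor_space,
      lo_V [:: B12a^-1] = ~` lo_V [:: B12a]
    & forall (eps : R) (irr : irrational eps),
        dense_in (lo_orbit (affine_ordering irr)) (lo_V [:: B12a]) /\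
        dense_in (lo_orbit (lo_opposite (affine_ordering irr))) (lo_V [:: B12a^-1])].
Proof.
have a1 : B12a <> 1.
  move=> /(congr1 (fun g => @xi R g 0)).
  by rewrite xi_a xi1 add0r => /eqP; rewrite oner_eq0.
have no_isolated (o : leftOrdering B12) : ~ lo_isolated o.
  have [_ _ /(_ _ a1)[Pa|PaV]] := positive_cone o.
    exact: (@lo_V_a_not_isolated R).
  move=> /lo_isolated_opposite; apply: (@lo_V_a_not_isolated R).
  exact/positive_opposite.
split=> //.
- (* Words in two letters are countable, and every element is represented by
     one. *)
  pose e (n : nat) : B12 := of_word B12_rel (odflt [::] (unpickle n)).
  have eK g : g = e (pickle (to_word g)).
    by rewrite /e pickleK /= to_wordK.
  apply: (@clopen_separated_cantor R _ (affine_ordering (@pi_irrationnal R))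
    (fun n => lo_V [:: e n])) => //.
  + exact: lo_compact.
  + by move=> n; exact: lo_V1_clopen.
  + move=> o o' /lo_separated[g]; rewrite (eK g) => Po Po'.
    by exists (pickle (to_word g)).
- exact: lo_V1C.
- move=> eps irr; have D := affine_orbit_dense irr; split=> //.
  rewrite lo_orbit_opposite lo_V1_opposite.
  exact: dense_in_opposite.
Qed.
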